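(* Let $L\ge 2$ and $M\ge 1$. Let $B\in\{1,\dots,L\}$ be the oracle label with uniform prior $\rho_1=\cdots=\rho_L=1/L$, and let $D=(D_1,\dots,D_M)\in\{1,\dots,L\}^M$ be local recommendations that are conditionally independent given $B$, with $\mathbb{P}(D=d\mid B=j)=\prod_{m=1}^M Q_m(d_m\mid j)$. Suppose every site $m$ has the same symmetric reliability matrix $$Q_m(a\mid j)=\begin{cases}\alpha, & a=j,\\ \beta, & a\ne j,\end{cases}\qquad \beta=\frac{1-\alpha}{L-1},\quad \alpha>\beta .$$ Then, under $0$-$1$ loss $C(i,j)=\mathbf{1}_{i\ne j}$, the Bayes rule is the majority voting rule: for every $d\in\{1,\dots,L\}^M$ with $\mathbb{P}(D=d)>0$, $$\arg\min_{1\le i\le L}\mathbb{P}(B\ne i\mid D=d)=\arg\max_{1\le a\le L}\sum_{m=1}^M\mathbf{1}_{d_m=a}$$ (equality of the sets of optimizers).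
   Context: $B=j$ means that experiment $\xi_j$, among candidates $\xi_1,\dots,\xi_L$, is the one a centralized oracle would select; $D_m$ is the index of the experiment recommended by site $m$, and $Q_m(a\mid j)=\mathbb{P}(D_m=a\mid B=j)$ is site $m$'s reliability matrix (recommendation channel), with $Q_m(a\mid j)\ge0$ and $\sum_{a=1}^L Q_m(a\mid j)=1$. A Bayes rule under $0$-$1$ loss is a fusion rule $\delta:\{1,\dots,L\}^M\to\{1,\dots,L\}$ that minimizes the conditional risk $\mathbb{P}(B\ne\delta(d)\mid D=d)$ for each observed $d$. The majority-vote rule is $\delta_{\mathrm{MV}}(d)=\arg\max_{1\le a\le L}\sum_{m=1}^M\mathbf{1}_{d_m=a}$. *)

(* Defs.v *)
From mathcomp Require Import all_boot all_order all_algebra.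
From mathcomp Require Import all_classical all_reals all_analysis.

Set Implicit Arguments.
Unset Strict Implicit.
Unset Printing Implicit Defensive.

Import Order.TTheory GRing.Theory Num.Theory.

Local Open Scope classical_set_scope.
Local Open Scope ring_scope.

(* The sets of optimizers (all of them, so ties are kept). *)
Definition argmin (I : Type) disp (V : porderType disp) (f : I -> V) : set I :=
  [set i | forall k, (f i <= f k)%O].

Definition argmax (I : Type) disp (V : porderType disp) (f : I -> V) : set I :=
  [set i | forall k, (f k <= f i)%O].

(* P(A | E), with the convention P(A | E) = 0 when P(E) = 0. *)
Definition cond_prob d (T : measurableType d) (R : realType)
    (P : probability T R) (A E : set T) : R :=
  fine (P (A `&` E)) / fine (P E).

(* 'I_L stands for the label set {1, ..., L}. It is empty when L = 0, hence not
   a measurableType (these are pointed), so measurability for its discrete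
   sigma-algebra is spelled out: all fibers are measurable. *)
Definition label_rv d (T : measurableType d) (L : nat) (X : T -> 'I_L) : Prop :=
  forall j : 'I_L, measurable (X @^-1` [set j]).

Section fusion.
Context d (T : measurableType d) (R : realType) (P : probability T R).
Context (L M : nat) (B : T -> 'I_L) (D : 'I_M -> T -> 'I_L).

(* the event D = x *)
Definition observed (x : {ffun 'I_M -> 'I_L}) : set T :=
  [set t | forall m, D m t = x m].

(* Q_m(a | j) = P(D_m = a | B = j) *)
Definition reliability (m : 'I_M) (a j : 'I_L) : R :=
  cond_prob P [set t | D m t = a] [set t | B t = j].

Definition cond_indep_given_label : Prop :=
  forall (j : 'I_L) (x : {ffun 'I_M -> 'I_L}),
    cond_prob P (observed x) [set t | B t = j] =
    \prod_(m < M) reliability m (x m) j.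

(* The conditional risk P(B <> i | D = x) of deciding i, i.e. the posterior
   expectation of the 0-1 loss C(i, B). *)
Definition cond_risk (x : {ffun 'I_M -> 'I_L}) (i : 'I_L) : R :=
  cond_prob P [set t | B t <> i] (observed x).

(* Recommendations of probability zero are never observed and leave a Bayes
   rule unconstrained. *)
Definition bayes_rule (delta : {ffun 'I_M -> 'I_L} -> 'I_L) : Prop :=
  forall x, (0 < P (observed x))%E -> argmin (cond_risk x) (delta x).

End fusion.

Definition votes (L M : nat) (x : {ffun 'I_M -> 'I_L}) (a : 'I_L) : nat :=
  (\sum_(m < M) (x m == a))%N.

(* Main.v *)
(* Under the uniform prior the joint probability P(D = x, B = i) is
   alpha^v beta^(M - v) / L, where v is the number of votes for i in x. The
   conditional risk is a decreasing affine function of this joint probability,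
   which is monotone in v since 0 <= beta < alpha; when beta = 0 it is strictly
   monotone only where it is positive, and P(D = x) > 0 ensures that it is
   positive for some label. *)
Require Import Defs.
From mathcomp Require Import all_boot all_order all_algebra.
From mathcomp Require Import all_classical all_reals all_analysis.

Set Implicit Arguments.
Unset Strict Implicit.
Unset Printing Implicit Defensive.

Import Order.TTheory GRing.Theory Num.Theory.

Local Open Scope classical_set_scope.
Local Open Scope ring_scope.

(** The map sending [y] to [(p - y) / p] is strictly decreasing, so it exchanges minimizers and
    maximizers. *)
Lemma argmin_sub_div (R : realType) (I : Type) (f : I -> R) (p : R) :
  0 < p -> argmin (fun i => (p - f i) / p) = argmax f.
Proof.
move=> p0; apply/seteqP; split=> i /= opt k; have := opt k;
  by rewrite /= ler_pM2r ?invr_gt0// lerD2l lerN2.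
Qed.

(** Monotonicity of [f] alone makes a maximizer of [v] one of [f \o v]. Conversely, a maximizer of
    [f \o v] has a positive value because some index does, so strict growth applies there and an
    index with larger [v] would beat it. *)
Lemma argmax_comp_incr (R : realType) (I : Type) (f : nat -> R) (v : I -> nat)
    (M : nat) :
  (forall i, (v i <= M)%N) ->
  (forall n m, (n <= m <= M)%N -> f n <= f m) ->
  (forall n m, (n < m <= M)%N -> 0 < f n -> f n < f m) ->
  (exists i, 0 < f (v i)) ->
  argmax (f \o v) = argmax v.
Proof.
move=> vM fle flt [j fj]; apply/seteqP; split=> i /= opt k; last first.
  by apply: fle; rewrite vM andbT; exact: opt.
rewrite leEnat leqNgt; apply/negP => vik.
have := flt (v i) (v k); rewrite vik vM => /(_ isT (lt_le_trans fj (opt j))).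
by rewrite ltNge (opt k).
Qed.

Section likelihood.
Context (R : realType) (a b : R) (M : nat).
Hypotheses (b0 : 0 <= b) (ba : b < a).

Let a0 : 0 < a. Proof. exact: le_lt_trans ba. Qed.

(** Both sides share the nonnegative factor [a ^+ n * b ^+ (M - m)]; what remains is
    [b ^+ (m - n) <= a ^+ (m - n)]. *)
Lemma likelihood_le n m : (n <= m <= M)%N ->
  a ^+ n * b ^+ (M - n) <= a ^+ m * b ^+ (M - m).
Proof.
move=> /andP[nm mM].
have -> : (M - n = (m - n) + (M - m))%N by rewrite addnC addnBA// subnK.
have -> : a ^+ m = a ^+ n * a ^+ (m - n) by rewrite -exprD subnKC.
rewrite exprD -mulrA ler_pM2l ?exprn_gt0//.
by rewrite ler_wpM2r ?exprn_ge0// lerXn2r ?nnegrE ?(ltW a0)// ltW.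
Qed.

Lemma likelihood_lt n m : (n < m <= M)%N -> 0 < a ^+ n * b ^+ (M - n) ->
  a ^+ n * b ^+ (M - n) < a ^+ m * b ^+ (M - m).
Proof.
move=> /andP[nm mM]; rewrite (pmulr_rgt0 _ (exprn_gt0 _ a0)) => bn.
(* If [b = 0], then [b ^+ (M - n)] vanishes because [n < M], against [bn]. *)
have bpos : 0 < b.
  rewrite lt0r b0 andbT; apply/eqP => b_0.
  by move: bn; rewrite b_0 expr0n subn_eq0 leqNgt (leq_trans nm mM) ltxx.
have -> : (M - n = (m - n) + (M - m))%N.
  by rewrite addnC addnBA ?subnK// ltnW.
have -> : a ^+ m = a ^+ n * a ^+ (m - n) by rewrite -exprD subnKC// ltnW.
rewrite exprD -mulrA ltr_pM2l ?exprn_gt0// ltr_pM2r ?exprn_gt0//.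
by rewrite ltrXn2r ?nnegrE ?(ltW a0)// subn_eq0 -ltnNge nm.
Qed.

End likelihood.

Lemma votes_le (L M : nat) (x : {ffun 'I_M -> 'I_L}) (i : 'I_L) :
  (votes x i <= M)%N.
Proof.
rewrite /votes -[leqRHS]card_ord -sum1_card.
by apply: leq_sum => m _; exact: leq_b1.
Qed.

(** The sites split into those voting for [i], each contributing [a], and the others, each
    contributing [b]. *)
Lemma prod_votes (R : realType) (L M : nat) (x : {ffun 'I_M -> 'I_L})
    (i : 'I_L) (a b : R) :
  \prod_(m < M) (if x m == i then a else b) =
  a ^+ votes x i * b ^+ (M - votes x i).
Proof.
have -> : votes x i = #|[pred m | x m == i]|.
  by rewrite /votes -big_mkcond sum1_card.
have -> : (M - #|[pred m | x m == i]| = #|[predC [pred m | x m == i]]|)%N.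
  by rewrite -[X in (X - _)%N]card_ord -(cardC [pred m | x m == i]) addKn.
rewrite -!prodr_const.
rewrite (bigID [pred m | x m == i])/=.
by congr (_ * _); apply: eq_bigr => m /=; [move=> ->|move=> /negPf ->].
Qed.

Section posterior.
Context d (T : measurableType d) (R : realType) (P : probability T R).
Context (L M : nat) (B : T -> 'I_L) (D : 'I_M -> T -> 'I_L).
Hypotheses (mB : label_rv B) (mD : forall m, label_rv (D m)).
Implicit Type x : {ffun 'I_M -> 'I_L}.

Lemma cond_prob_ge0 (A E : set T) : 0 <= cond_prob P A E.
Proof. by rewrite divr_ge0 ?fine_ge0. Qed.

Lemma measurable_observed x : measurable (observed D x).
Proof.
rewrite (_ : observed D x = \bigcap_(m in setT) (D m @^-1` [set x m])).
  by apply: fin_bigcap_measurable => // m _; exact: mD.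
by apply/seteqP; split=> t /= h m => [_|]; exact: h.
Qed.

Lemma measurable_observed_label x i :
  measurable (observed D x `&` [set t | B t = i]).
Proof. by apply: measurableI; [exact: measurable_observed|exact: mB]. Qed.

(** Within the observed event, [B <> i] is the complement of [B = i]. The form is the one
    [argmin_sub_div] expects. *)
Lemma cond_risk_joint x i :
  cond_risk P B D x i =
  (fine (P (observed D x)) - fine (P (observed D x `&` [set t | B t = i])))
  / fine (P (observed D x)).
Proof.
rewrite /cond_risk /cond_prob; congr (_ / _).
have mO := measurable_observed x.
rewrite setIC -[[set t | _]]/(~` [set t | B t = i]) -setDE.
rewrite measureD//; [|exact: mB|by rewrite ltey_eq fin_num_measure].
by rewrite fineB// fin_num_measure//; exact: measurable_observed_label.
Qed.

(** The values of [B] partition the observed event into finitely many pieces, which cannot all be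
    null. *)
Lemma joint_gt0 x : (0 < P (observed D x))%E ->
  exists i, 0 < fine (P (observed D x `&` [set t | B t = i])).
Proof.
move=> Ox; apply: contrapT => /forallNP none.
have null i : P (observed D x `&` [set t | B t = i]) = 0%E.
  apply/eqP; rewrite -fine_eq0; last first.
    by rewrite fin_num_measure//; exact: measurable_observed_label.
  by rewrite eq_le fine_ge0// andbT leNgt; apply/negP; exact: none.
have cover : observed D x =
    \bigcup_(i in setT) (observed D x `&` [set t | B t = i]).
  by apply/seteqP; split=> t /= => [Ot|[? _ [//]]]; exists (B t).
move: Ox; rewrite cover measure_fin_bigcup//.
- by rewrite fsbig1 ?ltxx// => i _; exact: null.
- exact: finite_finset.
- by move=> i j _ _ [t [[_ <-] [_ <-]]].
- by move=> i _; exact: measurable_observed_label.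
Qed.

End posterior.

Theorem proposition1 (d : measure_display) (T : measurableType d)
    (R : realType) (P : probability T R) (L M : nat)
    (hL : (2 <= L)%N) (hM : (1 <= M)%N)
    (B : T -> 'I_L) (D : 'I_M -> T -> 'I_L)
    (mB : label_rv B) (mD : forall m, label_rv (D m))
    (alpha beta : R)
    (uniform_prior : forall j : 'I_L, P [set t | B t = j] = (1 / L%:R)%:E)
    (condD : cond_indep_given_label P B D)
    (symQ : forall (m : 'I_M) (a j : 'I_L),
      reliability P B D m a j = if a == j then alpha else beta)
    (hbeta : beta = (1 - alpha) / (L%:R - 1))
    (hab : beta < alpha) :
  (forall x : {ffun 'I_M -> 'I_L}, (0 < P (observed D x))%E ->
     argmin (cond_risk P B D x) = argmax (votes x)) /\
  (forall delta : {ffun 'I_M -> 'I_L} -> 'I_L,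
     bayes_rule P B D delta <->
     (forall x, (0 < P (observed D x))%E -> argmax (votes x) (delta x))).
Proof.
have L0 : (0 < L)%N by exact: ltnW.
have beta0 : 0 <= beta.
  (* At site 0, [beta] is the conditional probability of recommending label 0 given the distinct
     label 1. *)
  have := symQ (Ordinal hM) (Ordinal L0) (Ordinal hL).
  by rewrite -val_eqE/= => <-; exact: cond_prob_ge0.
pose lik n := alpha ^+ n * beta ^+ (M - n).
have joint x i : fine (P (observed D x `&` [set t | B t = i])) =
    lik (votes x i) / L%:R.
  rewrite /lik -prod_votes; have := condD i x.
  (* Conditioning on [B = i] divides by [1 / L], that is, multiplies by [L], which is nonzero and
     can be cancelled. *)
  rewrite /cond_prob uniform_prior/= div1r invrK.
  under eq_bigr do rewrite symQ.
  by move=> <-; rewrite mulfK// pnatr_eq0 -lt0n.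
have argminE x : (0 < P (observed D x))%E ->
    argmin (cond_risk P B D x) = argmax (votes x).
  move=> Ox.
  have p0 : 0 < fine (P (observed D x)).
    by rewrite fine_gt0// Ox ltey_eq fin_num_measure//; exact: measurable_observed.
  rewrite (funext (cond_risk_joint P mB mD x)) argmin_sub_div//.
  rewrite (funext (joint x)).
  apply: (@argmax_comp_incr _ _ (fun n => lik n / L%:R) _ M).
  - exact: votes_le.
  - by move=> n m nm; rewrite ler_pM2r ?invr_gt0 ?ltr0n// likelihood_le.
  - move=> n m nm; rewrite pmulr_lgt0 ?invr_gt0 ?ltr0n// => n0.
    by rewrite ltr_pM2r ?invr_gt0 ?ltr0n// likelihood_lt.
  - have [i] := joint_gt0 mB mD Ox; rewrite joint => i0.
    by exists i.
split=> // delta; split=> opt x Ox.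
  by rewrite -argminE//; exact: opt.
by rewrite argminE//; exact: opt.
Qed.
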